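(* Let $\mathcal{H}$ be a complex Hilbert space, and for every generalized Drazin invertible $S\in\mathcal{B}(\mathcal{H})$ with closed range let a fixed inner inverse $S^{-}$ of $S$ be chosen. Let $\mathcal{PO}$ be the set of all generalized Drazin invertible operators $S\in\mathcal{B}(\mathcal{H})$ with closed range such that $$\|S^d\|\leq1\quad\text{and}\quad\lim_{n\to\infty}\left\|S^{n+2}S^dS^{-}-S^{n+1}S^d\right\|=0.$$ Then the relation $\leq^{GD-}$ is a pre-order (reflexive and transitive) on $\mathcal{PO}$.
   Context: $\mathcal{B}(\mathcal{H})$ is the space of bounded linear operators on $\mathcal{H}$. An operator $Q$ is quasinilpotent if $\|Q^n\|^{1/n}\to0$. $S\in\mathcal{B}(\mathcal{H})$ is generalized Drazin invertible if there is $X\in\mathcal{B}(\mathcal{H})$ with $XSX=X$, $SX=XS$ and $S-S^2X$ quasinilpotent; such an $X$ is unique and is denoted $S^d$. An inner inverse of $S$ is $S^{-}\in\mathcal{B}(\mathcal{H})$ with $SS^{-}S=S$ (one exists iff the range of $S$ is closed). The GD1 inverse of $S$ associated with its fixed inner inverse $S^{-}$ is $S^{GD-}=S^dSS^{-}$. The relation $S\leq^{GD-}T$ means $SS^{GD-}=TS^{GD-}$ and $S^{GD-}S=S^{GD-}T$. *)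

(* Defs.v *)
From HB Require Import structures.
From mathcomp Require Import all_boot all_order all_algebra.
From mathcomp Require Import complex.
From mathcomp Require Import all_classical all_reals all_analysis.

Set Implicit Arguments.
Unset Strict Implicit.
Unset Printing Implicit Defensive.

Import Order.TTheory GRing.Theory Num.Theory.
Import numFieldNormedType.Exports.

Local Open Scope classical_set_scope.
Local Open Scope ring_scope.

(* [dotp] is linear in its first argument and conjugate-linear in the second. *)
HB.mixin Record NormedModule_isHilbert (R : realType) (H : Type)
    of CompleteNormedModule R[i] H := {
  dotp : {dot H for (@Num.conj R[i] : R[i] -> R[i])} ;
  dotp_norm : forall x : H, `|x| ^+ 2 = dotp x x
}.

#[short(type="hilbertType")]
HB.structure Definition Hilbert (R : realType) :=
  {H of NormedModule_isHilbert R H & CompleteNormedModule R[i] H}.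

(* No sign is imposed on the bound [M]; see [bounded_op_ge0]. *)
Record bounded_op (K : numFieldType) (V : normedModType K) := BoundedOp {
  bounded_op_fun :> V -> V ;
  bounded_op_linear : linear bounded_op_fun ;
  bounded_op_bounded : exists M : K, forall x, `|bounded_op_fun x| <= M * `|x|
}.

Notation "''B' ( V )" := (bounded_op V) (at level 8, format "''B' ( V )").

Section BoundedOpRing.
Variables (K : numFieldType) (V : normedModType K).
Implicit Types S T U : 'B(V).

Lemma bounded_opP S T : S =1 T -> S = T.
Proof.
case: S T => [f fl fb] [g gl gb] /= /funext fg; case: _ / fg in gl gb *.
by congr BoundedOp; exact: Prop_irrelevance.
Qed.

HB.instance Definition _ S :=
  GRing.isLinear.Build K V V *:%R S (bounded_op_linear S).

HB.instance Definition _ := gen_eqMixin 'B(V).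
HB.instance Definition _ := gen_choiceMixin 'B(V).

Lemma bounded_op_ge0 S : exists2 M : K, 0 <= M & forall x, `|S x| <= M * `|x|.
Proof.
have [M SM] := bounded_op_bounded S; exists `|M| => // x.
by rewrite -(normr_id x) -normrM ger0_norm// (le_trans _ (SM x)).
Qed.

Fact bounded_op0_bounded : exists M : K, forall x : V, `|(0 : V)| <= M * `|x|.
Proof. by exists 0 => x; rewrite normr0 mul0r. Qed.

Fact bounded_op0_linear : linear (fun _ : V => 0 : V).
Proof. by move=> a x y; rewrite scaler0 addr0. Qed.

Definition bounded_op0 : 'B(V) :=
  BoundedOp bounded_op0_linear bounded_op0_bounded.

Fact bounded_op1_bounded : exists M : K, forall x : V, `|x| <= M * `|x|.
Proof. by exists 1 => x; rewrite mul1r. Qed.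

Definition bounded_op1 : 'B(V) :=
  @BoundedOp _ V idfun (fun _ _ _ => erefl) bounded_op1_bounded.

Fact bounded_opN_linear S : linear (fun x => - S x).
Proof. by move=> a x y; rewrite linearP opprD scalerN. Qed.

Fact bounded_opN_bounded S : exists M : K, forall x, `|- S x| <= M * `|x|.
Proof. by have [M SM] := bounded_op_bounded S; exists M => x; rewrite normrN. Qed.

Definition bounded_opN S : 'B(V) :=
  BoundedOp (bounded_opN_linear S) (bounded_opN_bounded S).

Fact bounded_opD_linear S T : linear (fun x => S x + T x).
Proof. by move=> a x y; rewrite !linearP scalerDr addrACA. Qed.

Fact bounded_opD_bounded S T :
  exists M : K, forall x, `|S x + T x| <= M * `|x|.
Proof.
have [M SM] := bounded_op_bounded S; have [N TN] := bounded_op_bounded T.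
by exists (M + N) => x; rewrite (le_trans (ler_normD _ _))// mulrDl lerD.
Qed.

Definition bounded_opD S T : 'B(V) :=
  BoundedOp (bounded_opD_linear S T) (bounded_opD_bounded S T).

Fact bounded_opM_linear S T : linear (S \o T).
Proof. by move=> a x y; rewrite /= !linearP. Qed.

Fact bounded_opM_bounded S T :
  exists M : K, forall x, `|(S \o T) x| <= M * `|x|.
Proof.
have [M M0 SM] := bounded_op_ge0 S; have [N TN] := bounded_op_bounded T.
by exists (M * N) => x; rewrite (le_trans (SM _))// -mulrA ler_wpM2l.
Qed.

Definition bounded_opM S T : 'B(V) :=
  BoundedOp (bounded_opM_linear S T) (bounded_opM_bounded S T).

Fact bounded_opDA : associative bounded_opD.
Proof. by move=> S T U; apply: bounded_opP => x /=; rewrite addrA. Qed.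

Fact bounded_opDC : commutative bounded_opD.
Proof. by move=> S T; apply: bounded_opP => x /=; rewrite addrC. Qed.

Fact bounded_op0D : left_id bounded_op0 bounded_opD.
Proof. by move=> S; apply: bounded_opP => x /=; rewrite add0r. Qed.

Fact bounded_opND : left_inverse bounded_op0 bounded_opN bounded_opD.
Proof. by move=> S; apply: bounded_opP => x /=; rewrite addNr. Qed.

HB.instance Definition _ := GRing.isZmodule.Build 'B(V)
  bounded_opDA bounded_opDC bounded_op0D bounded_opND.

Fact bounded_opMA : associative bounded_opM.
Proof. by move=> S T U; exact: bounded_opP. Qed.

Fact bounded_op1M : left_id bounded_op1 bounded_opM.
Proof. by move=> S; exact: bounded_opP. Qed.

Fact bounded_opM1 : right_id bounded_op1 bounded_opM.
Proof. by move=> S; exact: bounded_opP. Qed.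

Fact bounded_opMDl : left_distributive bounded_opM +%R.
Proof. by move=> S T U; exact: bounded_opP. Qed.

Fact bounded_opMDr : right_distributive bounded_opM +%R.
Proof. by move=> S T U; apply: bounded_opP => x /=; rewrite linearD. Qed.

(* The product is composition; the ring is trivial when [V] is, hence [Pz]. *)
HB.instance Definition _ := GRing.Zmodule_isPzRing.Build 'B(V)
  bounded_opMA bounded_op1M bounded_opM1 bounded_opMDl bounded_opMDr.

End BoundedOpRing.

Section GD1.
Variables (R : realType) (H : hilbertType R).
Implicit Types S T X Q : 'B(H).

(* The norm of [H] takes its values in [R[i]]; they are real, so [Re] only
   changes their type. *)
Definition opnorm T : R :=
  sup [set complex.Re `|T x| | x in [set x : H | `|x| <= 1]].

Definition quasinilpotent Q : Prop :=
  (opnorm (Q ^+ n) `^ n%:R^-1)%R @[n --> \oo] --> (0 : R).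

Definition is_gdrazin S X : Prop :=
  [/\ X * S * X = X, S * X = X * S & quasinilpotent (S - S ^+ 2 * X)].

Definition gdrazin_invertible S : Prop := exists X, is_gdrazin S X.

(* An [X] with [is_gdrazin S X] is unique, so [xget] makes no real choice; the
   value is 0 when there is none. *)
Definition gdrazin S : 'B(H) := xget 0 [set X | is_gdrazin S X].

Definition inner_inverse S X : Prop := S * X * S = S.

Variable inn : 'B(H) -> 'B(H).

(* Nothing is required of [inn S] for the other operators [S]: neither [PO] nor
   [gd1_le] restricted to [PO] depends on those values. *)
Definition inner_inverse_choice : Prop :=
  forall S, gdrazin_invertible S -> closed (range S) -> inner_inverse S (inn S).

Definition gd1 S : 'B(H) := gdrazin S * S * inn S.

Definition gd1_le S T : Prop := S * gd1 S = T * gd1 S /\ gd1 S * S = gd1 S * T.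

Definition PO : set 'B(H) := [set S |
  [/\ gdrazin_invertible S, closed (range S), opnorm (gdrazin S) <= 1 &
      opnorm (S ^+ (n + 2) * gdrazin S * inn S - S ^+ (n + 1) * gdrazin S)
        @[n --> \oo] --> (0 : R)]].

End GD1.

Definition preorder_on (T : Type) (A : set T) (r : T -> T -> Prop) : Prop :=
  (forall x, A x -> r x x) /\
  (forall x y z, A x -> A y -> A z -> r x y -> r y z -> r x z).

(* Main.v *)
Require Import Defs.
From HB Require Import structures.
From mathcomp Require Import all_boot all_order all_algebra.
From mathcomp Require Import complex.
From mathcomp Require Import all_classical all_reals all_analysis.

(** Writing [d] for the generalized Drazin inverse of [S], the commutation rules
give [d ^+ n.+1 * (S ^+ (n + 2) * d * inn S - S ^+ (n + 1) * d) =
d * S * inn S - d]; since [opnorm d <= 1], the limit condition forces the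
right-hand side to vanish, that is [gd1 S = d] on [PO]. So [S <= T] means [S *
d = T * d] and [d * S = d * T], whence [T ^+ n * d ^+ n * d = d = d * (d ^+ n
* T ^+ n)] for all [n]: the complement of the spectral idempotent [T * T^d]
kills [d] on both sides because its product with [T ^+ n] is the [n]-th power
of a quasinilpotent operator. Transitivity is then algebra. *)

Set Implicit Arguments.
Unset Strict Implicit.
Unset Printing Implicit Defensive.

Import Order.TTheory GRing.Theory Num.Theory.
Import numFieldNormedType.Exports.

Local Open Scope classical_set_scope.
Local Open Scope ring_scope.

Section OperatorNorm.
Variables (R : realType) (H : hilbertType R).
Implicit Types (S T : 'B(H)) (x : H).

Lemma norm_ReE x : `|x| = (complex.Re `|x|)%:C%C.
Proof. by rewrite RRe_real// ger0_real. Qed.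

Lemma Re_norm_ge0 x : 0 <= complex.Re `|x|.
Proof. by rewrite -lecR -norm_ReE rmorph0. Qed.

(** [sup] defaults to 0 on an unbounded set, so boundedness has to be known before [opnorm] can be
    compared with the values it bounds. *)
Lemma has_sup_opnorm T :
  has_sup [set complex.Re `|T x| | x in [set x : H | `|x| <= 1]].
Proof.
split; first by exists (complex.Re `|T 0|), 0 => //=; rewrite normr0.
have [M M0 TM] := bounded_op_ge0 T.
exists (complex.Re M) => _ [x /= x1 <-].
rewrite -lecR -norm_ReE RRe_real ?ger0_real// (le_trans (TM x))//.
by rewrite ler_piMr.
Qed.

Lemma opnorm_ge0 T : 0 <= opnorm T.
Proof.
apply: le_trans (Re_norm_ge0 (T 0)) _.
apply: ub_le_sup; first by case: (has_sup_opnorm T).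
by exists 0 => //=; rewrite normr0.
Qed.

Lemma opnorm_apply T x : complex.Re `|T x| <= opnorm T * complex.Re `|x|.
Proof.
have [->|x0] := eqVneq x 0.
  by rewrite raddf0 normr0 mulr0.
have nx : 0 < complex.Re `|x| by rewrite -ltcR -norm_ReE rmorph0 normr_gt0.
rewrite -ler_pdivrMr//.
(* The supremum runs over the unit ball, so a nonzero [x] is rescaled into it. *)
have n1 : `|(`|x|^-1 *: x)| = 1.
  by rewrite normrZ normfV normr_id mulVf// normr_eq0.
apply: ub_le_sup; first by case: (has_sup_opnorm T).
exists (`|x|^-1 *: x); first by rewrite /= n1.
rewrite linearZ normrZ normfV normr_id {1}norm_ReE (norm_ReE (T x)).
by rewrite -fmorphV -rmorphM /= mulrC.
Qed.

Lemma opnorm_le T (M : R) :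
  0 <= M -> (forall x, complex.Re `|T x| <= M * complex.Re `|x|) ->
  opnorm T <= M.
Proof.
move=> M0 TM; apply: ge_sup; first by case: (has_sup_opnorm T).
move=> _ [x /= x1 <-]; apply: le_trans (TM x) _.
by rewrite ler_piMr// -lecR -norm_ReE rmorph1.
Qed.

Lemma opnormM S T : opnorm (S * T) <= opnorm S * opnorm T.
Proof.
apply: opnorm_le => [|x]; first by rewrite mulr_ge0 ?opnorm_ge0.
apply: le_trans (opnorm_apply S (T x)) _.
by rewrite -mulrA ler_wpM2l ?opnorm_ge0 ?opnorm_apply.
Qed.

Lemma opnormX T n : opnorm (T ^+ n) <= opnorm T ^+ n.
Proof.
elim: n => [|n IHn].
  (* If [H] is the zero space, the identity has norm 0 and the bound 1 is strict. *)
  by rewrite !expr0; apply: opnorm_le => // x; rewrite mul1r.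
rewrite !exprS; apply: le_trans (opnormM _ _) _.
by rewrite ler_wpM2l ?opnorm_ge0.
Qed.

Lemma opnorm_le0 T : opnorm T <= 0 -> T = 0.
Proof.
move=> T0; apply: bounded_opP => x /=; apply/eqP; rewrite -normr_eq0 norm_ReE.
rewrite (_ : complex.Re _ = 0)//; apply/eqP; rewrite eq_le Re_norm_ge0 andbT.
apply: le_trans (opnorm_apply T x) _.
by rewrite mulr_le0_ge0 ?Re_norm_ge0.
Qed.

Lemma opnorm_cvg0_eq0 T (u : R^nat) :
  (\forall n \near \oo, opnorm T <= u n) -> u @ \oo --> (0 : R) -> T = 0.
Proof.
move=> Tu u0; apply: opnorm_le0.
by rewrite -(cvg_lim (@Rhausdorff R) u0); apply: limr_ge => //; apply/cvg_ex;
  exists 0.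
Qed.

(** The n-th roots eventually drop below any [e > 0]; taking [e * c <= 1/2] leaves a geometric
    majorant. The [c + 1] in [e] covers [c = 0]. *)
Lemma quasinilpotent_cvg0 (Q : 'B(H)) (c : R) : quasinilpotent Q -> 0 <= c ->
  opnorm (Q ^+ n) * c ^+ n @[n --> \oo] --> (0 : R).
Proof.
move=> Q0 c0; pose e : R := (2 * (c + 1))^-1.
have c1 : 0 < c + 1 by rewrite ltr_wpDl.
have e0 : 0 < e by rewrite invr_gt0 mulr_gt0.
have ec : e * c <= 2^-1.
  by rewrite /e invfM -mulrA ler_piMr// mulrC ler_pdivrMr// mul1r lerDl.
apply: (@squeeze_cvgr _ _ _ _ (cst 0) (fun n => (2^-1 : R) ^+ n)); last 2 first.
- exact: cvg_cst.
- by apply: cvg_expr; rewrite ger0_norm// invf_lt1// ltr1n.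
near=> n.
(* At [n = 0] the exponent [n%:R^-1] is 0 and the root cannot be undone. *)
have n0 : (0 < n)%N by near: n; exists 1%N.
rewrite mulr_ge0 ?opnorm_ge0 ?exprn_ge0//=.
have Qe : opnorm (Q ^+ n) `^ n%:R^-1 <= e.
  by near: n; apply: (cvgr_le _ Q0).
have Qn : opnorm (Q ^+ n) <= e ^+ n.
  rewrite -[leLHS]powRr1 ?opnorm_ge0// -(@mulVf _ n%:R) ?pnatr_eq0 -?lt0n//.
  by rewrite powRrM powR_mulrn ?powR_ge0// lerXn2r ?nnegrE ?powR_ge0 ?(ltW e0).
apply: le_trans (ler_wpM2r (exprn_ge0 _ c0) Qn) _.
by rewrite -exprMn lerXn2r ?nnegrE ?invr_ge0// mulr_ge0// ltW.
Unshelve. all: by end_near. Qed.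

End OperatorNorm.

(** Since [d = y * (t * d)], the equality of [t] and [u] on [y] passes to [d]. In the transitivity
    proof [y] and [d] are the generalized Drazin inverses of [T] and [S]. *)
Lemma eq_mul_absorbl (A : pzRingType) (t u y d : A) :
  t * y * d = d -> t * y = y * t -> t * y = u * y -> t * d = u * d.
Proof. by move=> tyd ty tu; rewrite -tyd ty !mulrA tu. Qed.

Lemma eq_mul_absorbr (A : pzRingType) (t u y d : A) :
  d * (t * y) = d -> y * t = y * u -> d * t = d * u.
Proof. by move=> dty tu; rewrite -dty -!mulrA tu. Qed.

Section GeneralizedDrazin.
Variables (R : realType) (H : hilbertType R).
Implicit Types S T X Y A D : 'B(H).

Lemma is_gdrazin_gdrazin S : gdrazin_invertible S -> is_gdrazin S (gdrazin S).
Proof. exact: xgetPex. Qed.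

(** The quasinilpotent part is [T * e], where [e = 1 - T * X] is an idempotent commuting with [T];
    [e ^+ n = e] holds from [n = 1] on. *)
Lemma gdrazin_compl_exp T X n : is_gdrazin T X -> (0 < n)%N ->
  (T - T ^+ 2 * X) ^+ n = (1 - T * X) * T ^+ n /\
  (T - T ^+ 2 * X) ^+ n = T ^+ n * (1 - T * X).
Proof.
move=> [XTX TX _] n0; set e := 1 - T * X.
have cTe : GRing.comm T e.
  by rewrite /GRing.comm /e mulrBr mulrBl mulr1 mul1r -mulrA -TX.
have idem_e : e * e = e.
  rewrite {2}/e mulrBr mulr1 /e mulrBl mul1r -mulrA (mulrA X) XTX.
  by rewrite subrr subr0.
have en : e ^+ n = e.
  by case: n n0 => // n _; elim: n => // n IHn; rewrite exprS IHn idem_e.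
have -> : T - T ^+ 2 * X = T * e by rewrite mulrBr mulr1 mulrA expr2.
rewrite exprMn_comm// en; split=> //.
by apply: commr_sym; apply: commrX; exact: commr_sym.
Qed.

(** With [Q] the quasinilpotent part, [A - T * X * A = Q ^+ n * D ^+ n * A] for every [n > 0], and
    quasinilpotence beats the growth of [opnorm D ^+ n]. *)
Lemma gdrazin_absorbl T X D A : is_gdrazin T X ->
  (forall n, T ^+ n * D ^+ n * A = A) -> T * X * A = A.
Proof.
move=> TX AE; apply/esym/eqP; rewrite -subr_eq0; apply/eqP.
apply: (@opnorm_cvg0_eq0 _ _ _ (fun n => opnorm ((T - T ^+ 2 * X) ^+ n) *
    opnorm D ^+ n * opnorm A)).
  near=> n.
  have n0 : (0 < n)%N by near: n; exists 1%N.
  rewrite -{1 2}(AE n) -{1}(mul1r (_ * A)) -mulrBl 2!mulrA.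
  rewrite -(gdrazin_compl_exp TX n0).1.
  apply: le_trans (opnormM _ _) _; rewrite ler_wpM2r ?opnorm_ge0//.
  by apply: le_trans (opnormM _ _) _; rewrite ler_wpM2l ?opnorm_ge0 ?opnormX.
rewrite -(mul0r (opnorm A)); apply: cvgM; last exact: cvg_cst.
by apply: quasinilpotent_cvg0; rewrite ?opnorm_ge0//; case: TX.
Unshelve. all: by end_near. Qed.

Lemma gdrazin_absorbr T X D A : is_gdrazin T X ->
  (forall n, A * (D ^+ n * T ^+ n) = A) -> A * (T * X) = A.
Proof.
move=> TX AE; apply/esym/eqP; rewrite -subr_eq0; apply/eqP.
apply: (@opnorm_cvg0_eq0 _ _ _ (fun n => opnorm A *
    (opnorm ((T - T ^+ 2 * X) ^+ n) * opnorm D ^+ n))).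
  near=> n.
  have n0 : (0 < n)%N by near: n; exists 1%N.
  rewrite -{1 2}(AE n) -{1}(mulr1 (A * _)) -mulrBr -2!mulrA.
  rewrite -(gdrazin_compl_exp TX n0).2.
  apply: le_trans (opnormM _ _) _; rewrite ler_wpM2l ?opnorm_ge0//.
  apply: le_trans (opnormM _ _) _; rewrite mulrC.
  by rewrite ler_wpM2l ?opnorm_ge0 ?opnormX.
rewrite -(mulr0 (opnorm A)); apply: cvgM; first exact: cvg_cst.
by apply: quasinilpotent_cvg0; rewrite ?opnorm_ge0//; case: TX.
Unshelve. all: by end_near. Qed.

Lemma gdrazin_expl S X n : is_gdrazin S X -> S ^+ n * X ^+ n * X = X.
Proof.
move=> [XSX SX _]; elim: n => [|n IHn]; first by rewrite !expr0 !mul1r.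
rewrite exprSr exprS -!mulrA -exprSr exprS (mulrA S) SX.
by rewrite (mulrA (X * S)) XSX -exprS exprSr mulrA.
Qed.

Lemma gdrazin_expr S X n : is_gdrazin S X -> X * (X ^+ n * S ^+ n) = X.
Proof.
move=> SX; have cSX : GRing.comm S X by case: SX.
have cXX : GRing.comm X (S ^+ n * X ^+ n).
  by apply: commrM; apply: commrX => //; exact: commr_sym.
rewrite (_ : X ^+ n * S ^+ n = S ^+ n * X ^+ n); last first.
  by apply: commrX; apply: commr_sym; exact: commrX.
by rewrite cXX gdrazin_expl.
Qed.

Lemma gdrazin_dominatedl S T X Y : is_gdrazin S X -> is_gdrazin T Y ->
  S * X = T * X -> T * Y * X = X.
Proof.
move=> SX TY STX; apply: (@gdrazin_absorbl _ _ X) => // n.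
(* What remains is [T ^+ n * X = S ^+ n * X], by induction: [T * X] becomes [S * X = X * S], which
   frees [X] for the induction hypothesis. *)
rewrite -[RHS](gdrazin_expl n SX) -!mulrA -exprSr exprS !mulrA; congr (_ * _).
have [_ cSX _] := SX; elim: n => [|n IHn]; first by rewrite !expr0.
by rewrite exprSr -mulrA -STX cSX mulrA IHn -mulrA -cSX mulrA -exprSr.
Qed.

Lemma gdrazin_dominatedr S T X Y : is_gdrazin S X -> is_gdrazin T Y ->
  X * S = X * T -> X * (T * Y) = X.
Proof.
move=> SX TY STX; apply: (@gdrazin_absorbr _ _ X) => // n.
rewrite -[RHS](gdrazin_expr n SX) !mulrA -exprS exprSr -!mulrA; congr (_ * _).
have [_ cSX _] := SX; elim: n => [|n IHn]; first by rewrite !expr0.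
by rewrite exprS mulrA -STX -cSX -mulrA IHn mulrA cSX -mulrA -exprS.
Qed.

Lemma gd1_PO (inn : 'B(H) -> 'B(H)) S : PO inn S -> gd1 inn S = gdrazin S.
Proof.
move=> [Sinv _ d1 S0]; have Sd := is_gdrazin_gdrazin Sinv.
rewrite /gd1; set d := gdrazin S in d1 S0 Sd *.
apply/eqP; rewrite -subr_eq0; apply/eqP.
apply: opnorm_cvg0_eq0 S0; near=> n.
set E := (X in _ <= opnorm X).
(* [d ^+ n.+1] has norm at most 1, so the fixed operator on the left is dominated by the null
   sequence [opnorm E]. *)
suff -> : d * S * inn S - d = d ^+ n.+1 * E.
  apply: le_trans (opnormM _ _) _; rewrite ler_piMl ?opnorm_ge0//.
  by apply: le_trans (opnormX _ _) _; rewrite exprn_ile1 ?opnorm_ge0.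
have [dSd Sdc _] := Sd.
have cd m : S ^+ m * d = d * S ^+ m by rewrite (commrX m (commr_sym Sdc)).
have dS : d ^+ n.+1 * S ^+ n.+1 * d = d.
  rewrite -mulrA cd mulrA -exprSr exprS -mulrA; exact: gdrazin_expr.
have dSS : d ^+ n.+1 * S ^+ n.+2 * d = d * S.
  by rewrite (exprSr S) -!mulrA Sdc !mulrA dS.
rewrite /E addn1 addn2 mulrBr (mulrA _ (_ * d)).
by rewrite !(mulrA _ (S ^+ _) d) dS dSS.
Unshelve. all: by end_near. Qed.

End GeneralizedDrazin.

Theorem corollary3 (R : realType) (H : hilbertType R) (inn : 'B(H) -> 'B(H))
  (inn_choice : inner_inverse_choice inn) :
  preorder_on (PO inn) (gd1_le inn).
Proof.
split=> [S _|S T U POS POT _]; first by split.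
rewrite /gd1_le (gd1_PO POS) (gd1_PO POT) => -[STl STr] [TUl TUr].
have Sd : is_gdrazin S (gdrazin S) by case: POS => /is_gdrazin_gdrazin.
have Td : is_gdrazin T (gdrazin T) by case: POT => /is_gdrazin_gdrazin.
(* The idempotent [T * gdrazin T] fixes [gdrazin S] on both sides, which lets the relation between
   [T] and [U] be transferred to [gdrazin S]. *)
have TdS := gdrazin_dominatedl Sd Td STl.
have SdT := gdrazin_dominatedr Sd Td STr.
have Tc : T * gdrazin T = gdrazin T * T by case: Td.
split; first exact: etrans STl (eq_mul_absorbl TdS Tc TUl).
exact: etrans STr (eq_mul_absorbr SdT TUr).
Qed.
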